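(* Let $\mathcal{I}=(I_n)_{n\in\mathbb{N}}$ be a $\mathrm{Sym}(\infty)$-invariant filtration of graded ideals, that is, a sequence of graded ideals $I_n\subset K[X_n]$ such that $\mathrm{Sym}(n)(I_m)\subseteq I_n$ whenever $m\le n$. Then its bigraded Hilbert series is rational and can be written in the form $$H_{\mathcal{I}}(s,t)=\frac{g(s,t)}{(1-t)^a\cdot\prod_{j=1}^b[(1-t)^{c_j}-s\cdot f_j(t)]},$$ where $a,b,c_j$ are non-negative integers with $c_j\le c$, $g(s,t)\in\mathbb{Z}[s,t]$, and each $f_j(t)$ is a polynomial in $\mathbb{Z}[t]$ satisfying $f_j(1)>0$.
   Context: $K$ is an arbitrary field, $c\ge 1$ a fixed integer, $\mathbb{N}=\{1,2,\ldots\}$. For $n\in\mathbb{N}$ let $X_n=\{x_{j,k}\mid 1\le j\le c,\ 1\le k\le n\}$ and $X=\bigcup_{n\ge1}X_n$; $K[X_n]\subset K[X]$ are the polynomial rings over $K$ with the standard grading, $[M]_j$ denotes the degree $j$ component of a graded module $M$. $\mathrm{Sym}(n)$ is the group of bijections of $\{1,\ldots,n\}$, embedded in $\mathrm{Sym}(n+1)$ as the stabilizer of $n+1$, and $\mathrm{Sym}(\infty)=\bigcup_n\mathrm{Sym}(n)$; it acts on $K[X]$ by $K$-algebra homomorphisms via $\pi\cdot x_{j,k}=x_{j,\pi(k)}$. The bigraded Hilbert series of a filtration of graded ideals is the formal power series $H_{\mathcal{I}}(s,t)=\sum_{n\ge0,\,j\ge0}\dim_K[K[X_n]/I_n]_j\cdot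 s^nt^j$, with $I_0=0$ and $K[X_0]=K$. *)

(* Defs.v *)
From mathcomp Require Export all_boot all_order all_algebra fingroup perm.
From mathcomp Require Export mpoly.
From mathcomp Require Export boolp classical_sets.

Set Implicit Arguments.
Unset Strict Implicit.
Unset Printing Implicit Defensive.

Import GRing.Theory Num.Theory.

Local Open Scope ring_scope.
Local Open Scope classical_set_scope.

Section GradedIdeals.
Variables (K : fieldType) (n : nat).
Implicit Types (J : set {mpoly K[n]}) (p q : {mpoly K[n]}) (j d : nat).

(* The unit ideal is allowed, unlike in [idealr_closed]. *)
Definition graded_ideal J : Prop :=
  [/\ J 0,
      forall p q, J p -> J q -> J (p + q),
      forall p q, J q -> J (p * q)
    & forall j p, J p -> J (pihomog mdeg j p)].

(* The residue classes of the [e i] form a K-basis of [K[x_1..x_n]/J]_j, the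
   image in K[x_1..x_n]/J of the space of homogeneous polynomials of degree j. *)
Definition quot_basis J j d (e : 'I_d -> {mpoly K[n]}) : Prop :=
  [/\ forall i, e i \is j.-homog,
      forall a : 'I_d -> K, J (\sum_i a i *: e i) -> forall i, a i = 0
    & forall p, p \is j.-homog ->
        exists a : 'I_d -> K, J (p - \sum_i a i *: e i)].

(* dim_K [K[x_1..x_n]/J]_j; see [hilbert_funP] and [quot_basis_size]. *)
Definition hilbert_fun J j : nat :=
  xget 0%N [set d | exists e : 'I_d -> {mpoly K[n]}, quot_basis J j e].

Let quot_free J j d (e : 'I_d -> {mpoly K[n]}) : Prop :=
  (forall i, e i \is j.-homog) /\
  forall a : 'I_d -> K, J (\sum_i a i *: e i) -> forall i, a i = 0.

Let idealZ J (a : K) p : graded_ideal J -> J p -> J (a *: p).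
Proof. by case=> _ _ JM _ Jp; rewrite -mul_mpolyC; exact: JM. Qed.

Let ideal_sum J d (F : 'I_d -> {mpoly K[n]}) : graded_ideal J ->
  (forall i, J (F i)) -> J (\sum_i F i).
Proof. by case=> J0 JD _ _ JF; apply: (big_ind J). Qed.

Let quot_free_bound J j d (e : 'I_d -> {mpoly K[n]}) : graded_ideal J ->
  quot_free J j e -> (d <= #|{: 'X_{1..n < j.+1}}|)%N.
Proof.
case=> J0 _ _ _ [he fe].
pose A := \matrix_(i < d, k < #|{: 'X_{1..n < j.+1}}|)
            (e i)@_(enum_val k : 'X_{1..n < j.+1}).
suff /eqP <- : row_free A by exact: rank_leq_col.
apply: inj_row_free => v vA; apply/rowP=> i; rewrite mxE.
apply: (fe (fun i => v 0 i)); suff -> : \sum_i v 0 i *: e i = 0 by [].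
apply/mpolyP=> m; rewrite mcoeff0 raddf_sum /=.
case: (leqP j.+1 (mdeg m)) => [lt_jm | lt_mj].
  rewrite big1 // => k _; rewrite mcoeffZ (dhomog_nemf_coeff (he k)) ?mulr0 //.
  by apply/eqP=> mj; rewrite /= mj ltnn in lt_jm.
have /rowP/(_ (enum_rank (BMultinom lt_mj))) := vA.
rewrite mxE [RHS]mxE => vA0; rewrite -[RHS]vA0; apply: eq_bigr => k _.
by rewrite mcoeffZ mxE enum_rankK.
Qed.

Lemma hilbert_funP J j : graded_ideal J ->
  exists e : 'I_(hilbert_fun J j) -> {mpoly K[n]}, quot_basis J j e.
Proof.
move=> gJ; case: (gJ) => J0 JD JM JH.
rewrite /hilbert_fun; case: xgetP => [d _ //|nob]; exfalso.
pose P d := `[< exists e : 'I_d -> {mpoly K[n]}, quot_free J j e >].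
have P0 : exists d, P d.
  exists 0%N; apply/asboolP; exists (fun=> 0).
  by split=> [i|a _ i]; [exact: dhomog0 | case: i].
have bP d : P d -> (d <= #|{: 'X_{1..n < j.+1}}|)%N.
  by move=> /asboolP[e]; exact: quot_free_bound.
case: (ex_maxnP P0 bP) => d /asboolP[e [he fe]] maxd.
apply: (nob d); exists e; split=> // p hp; apply: contrapT => np.
suff /maxd : P d.+1 by rewrite ltnn.
apply/asboolP; exists (fun i => oapp e p (unlift ord0 i)); split=> [i|a].
  by case: (unlift ord0 i) => [k|] /=; [exact: he | exact: hp].
rewrite big_ord_recl unlift_none /=.
under eq_bigr => i _ do rewrite liftK /=.
move=> Ja; case: (eqVneq (a ord0) 0) => a0.
  rewrite a0 scale0r add0r in Ja; move: (fe (fun i => a (lift ord0 i)) Ja) => ai i.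
  by case: (unliftP ord0 i) => [k|] ->.
exfalso; apply: np; exists (fun i => - ((a ord0)^-1 * a (lift ord0 i))).
have := idealZ (a ord0)^-1 gJ Ja; rewrite scalerDr scalerA mulVf // scale1r.
congr (J (p + _)); rewrite scaler_sumr -sumrN.
by apply: eq_bigr => i _; rewrite scaleNr opprK scalerA.
Qed.

Let quot_basis_leq J j d d' (e : 'I_d -> {mpoly K[n]})
    (e' : 'I_d' -> {mpoly K[n]}) : graded_ideal J ->
  quot_basis J j e -> quot_basis J j e' -> (d <= d')%N.
Proof.
move=> gJ [he fe se] [he' _ se']; case: (gJ) => J0 JD JM JH.
have /choice[a aP] i := se' (e i) (he i).
have /choice[b bP] i := se (e' i) (he' i).
apply: (@mulmx1_min K d d' (\matrix_(i, k) a i k) (\matrix_(i, k) b i k)).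
apply/matrixP=> i l.
rewrite [RHS]mxE; set ab := (_ *m _) i; pose u l := ab l - (i == l)%:R.
suff /fe/(_ l)/eqP : J (\sum_l u l *: e l) by rewrite subr_eq0 => /eqP.
have Js : J (\sum_k a i k *: (e' k - \sum_l b k l *: e l)).
  by apply: ideal_sum => // k; exact: idealZ.
have -> : \sum_l u l *: e l
    = (\sum_k a i k *: \sum_l b k l *: e l) - e i.
  under eq_bigr => m _ do rewrite scalerBl.
  rewrite sumrB; congr (_ - _); last first.
    rewrite (bigD1 i) //= eqxx scale1r big1 ?addr0 // => k /negbTE.
    by rewrite eq_sym => ->; rewrite scale0r.
  under [RHS]eq_bigr => k _ do rewrite scaler_sumr.
  rewrite exchange_big; apply: eq_bigr => m _.
  rewrite /ab mxE scaler_suml; apply: eq_bigr => k _.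
  by rewrite scalerA !mxE.
have := idealZ (-1) gJ (JD _ _ (aP i) Js); congr J.
under [X in _ + X]eq_bigr => k _ do rewrite scalerBr.
by rewrite sumrB addrA subrK scaleN1r opprB.
Qed.

Lemma quot_basis_size J j d (e : 'I_d -> {mpoly K[n]}) : graded_ideal J ->
  quot_basis J j e -> hilbert_fun J j = d.
Proof.
move=> gJ be; have [e' be'] := hilbert_funP j gJ.
by apply/eqP; rewrite eqn_leq !(quot_basis_leq gJ be be', quot_basis_leq gJ be' be).
Qed.

End GradedIdeals.

Section Filtrations.
Variables (K : fieldType) (c : nat).

(* K[X_n] is {mpoly K[c * n]}: x_{j,k} is the variable of index
   [mxvec_index j k], and all indices start from 0. *)
Definition xvar n (j : 'I_c) (k : 'I_n) : {mpoly K[c * n]} :=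
  'X_(mxvec_index j k).

(* The action of pi in Sym(n) on K[X_m], viewed inside K[X_n] for m <= n: the
   K-algebra map sending x_{j,k} to x_{j,pi(k)}. *)
Definition sym_act m n (le_mn : (m <= n)%N) (pi : 'S_n)
    (p : {mpoly K[c * m]}) : {mpoly K[c * n]} :=
  p \mPo (mktuple (fun i =>
    let: (j, k) := enum_val (cast_ord (esym (mxvec_cast c m)) i) in
    xvar j (pi (widen_ord le_mn k)))).

Lemma sym_act_xvar m n (le_mn : (m <= n)%N) (pi : 'S_n) (j : 'I_c) (k : 'I_m) :
  sym_act le_mn pi (xvar j k) = xvar j (pi (widen_ord le_mn k)).
Proof.
by rewrite /sym_act comp_mpolyXU -tnth_nth tnth_mktuple cast_ordK enum_rankK.
Qed.
(* The ideals I_n are indexed by all n >= 0, with I_0 = 0. *)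
Definition sym_filtration (I : forall n, set {mpoly K[c * n]}) : Prop :=
  [/\ I 0%N = [set 0],
      forall n, graded_ideal (I n)
    & forall m n (le_mn : (m <= n)%N) (pi : 'S_n) p,
        I m p -> I n (sym_act le_mn pi p)].

End Filtrations.

(* Formal power series in Z[[s,t]]: [A n j] is the coefficient of s^n t^j. *)
Definition series2 := nat -> nat -> int.

Definition series2_mul (A B : series2) : series2 := fun n j =>
  \sum_(p < n.+1) \sum_(q < j.+1) A p q * B (n - p)%N (j - q)%N.

(* Z[s,t] is {poly {poly int}}: s is the outer variable ['X], and t the inner
   one ['X%:P]; a polynomial in t alone is embedded by [_%:P]. *)
Definition series2_of_poly (P : {poly {poly int}}) : series2 :=
  fun n j => P`_n`_j.

(* A = P / Q in Z[[s,t]], for Q with constant term 1, hence invertible. *)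
Definition series2_eq_frac (A : series2) (P Q : {poly {poly int}}) : Prop :=
  series2_mul A (series2_of_poly Q) = series2_of_poly P.

Definition bigraded_hilbert_series (K : fieldType) (c : nat)
    (I : forall n, set {mpoly K[c * n]}) : series2 :=
  fun n j => (hilbert_fun (I n) j)%:Z.

Definition hilbert_denom (a b : nat) (e : 'I_b -> nat) (f : 'I_b -> {poly int})
    : {poly {poly int}} :=
  (1 - 'X%:P) ^+ a * \prod_(j < b) ((1 - 'X%:P) ^+ e j - 'X * (f j)%:P).

Lemma hilbert_denom00 a b (e : 'I_b -> nat) (f : 'I_b -> {poly int}) :
  (hilbert_denom a e f)`_0`_0 = 1.
Proof.
rewrite -!horner_coef0 /hilbert_denom !(hornerE, horner_prod, horner_exp).
rewrite expr1n mul1r big1 // => j _.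
by rewrite !(hornerE, horner_exp) expr1n.
Qed.

(* Main.v *)
From HB Require Import structures.
From mathcomp Require Import ring zify.
Require Import Defs.

Set Implicit Arguments.
Unset Strict Implicit.
Unset Printing Implicit Defensive.

Import Order.TTheory GRing.Theory Num.Theory.

Local Open Scope ring_scope.
Local Open Scope classical_set_scope.

(** The idea is to count monomials, to read them as words over the alphabet of
    exponent vectors in N^c, and to peel off first letters.

    For the degree-lexicographic order, the monomials outside the initial ideal
    of I_n form a basis of K[X_n]/I_n (hilbert_fun_standard), so the bigraded
    Hilbert series counts these monomials by n and by degree. A monomial of
    K[X_n] is a word of length n: its k-th letter lists the exponents of
    x_{1,k}, ..., x_{c,k}. Renaming the columns along an increasing map keeps the
    relative order of the variables, hence commutes with taking leading
    monomials, and on K[X_m] it agrees with a permutation. So the initial ideals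
    are stable under inserting letters and under raising letters, and the words
    outside them form a language D that is closed downwards for the embedding
    order of Higman (standard_words_downset).

    The theorem thus becomes a statement on an arbitrary downward closed
    language D over N^c (downset_rational). For a letter a let D_a be the set of
    the words w with a w in D. Sorting words by their first letter gives
<<
      H_D = [the empty word is in D] + s sum_a t^|a| H_{D_a}.
>>
    Each D_a is contained in D. By Higman's lemma descending chains of downward
    closed languages are stationary (downset_stationary), so one may assume the
    result for the D_a other than D. The set A of the letters with D_a = D
    contributes s H_A(t) H_D to the right hand side, and
<<
      (1 - s H_A(t)) H_D = [the empty word is in D] + s sum_{a not in A} t^|a| H_{D_a}.
>>
    Since D_a decreases in a, chain stationarity also makes a |-> D_a eventually
    constant in each coordinate (left_quotient_tame). This turns the infinite sum on the
    right into finitely many operations and geometric series in t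
    (rational_letter_sum), and it shows that H_A(t) is 0 or p(t) / (1 - t)^d with
    d <= c and p(1) > 0 (positive_fraction_letter_sum). Hence 1 - s H_A(t)
    becomes an allowed factor (1 - t)^d - s p(t) after multiplication by
    (1 - t)^d. *)

(** * Well-quasi-orders and Higman's lemma *)

Section WellQuasiOrders.
Local Open Scope nat_scope.

Definition increasing_seq (g : nat -> nat) := forall i, g i < g i.+1.

Lemma increasing_seq_lt g i j : increasing_seq g -> i < j -> g i < g j.
Proof.
move=> gS; elim: j => // j IH; rewrite ltnS leq_eqVlt => /orP[/eqP->//|/IH].
by move/ltn_trans; apply.
Qed.

(** Well-quasi-orders are used in the form that passes to products at once:
    every sequence has an increasing subsequence. *)
Definition has_monotone_subseqs T (R : T -> T -> Prop) :=
  forall f : nat -> T, exists2 g, increasing_seq g &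
    forall i j, i < j -> R (f (g i)) (f (g j)).

Lemma leq_has_monotone_subseqs : has_monotone_subseqs leq.
Proof.
move=> f.
have minP n : exists i, n <= i /\ forall k, n <= k -> f i <= f k.
  have exv : exists v, `[< exists2 i, n <= i & f i = v >].
    by exists (f n); apply/asboolP; exists n.
  case: (ex_minnP exv) => v /asboolP[i ni <-] vmin; exists i; split=> // k nk.
  by apply: vmin; apply/asboolP; exists k.
have [next nextP] := choice minP.
pose g := fix g i := if i is i'.+1 then next (g i').+1 else next 0.
have gS : increasing_seq g by move=> i; case: (nextP (g i).+1).
exists g => // i j ij; have lt_ij := increasing_seq_lt gS ij.
case: i ij lt_ij => [|i] _ lt_ij.
  by have [_ le] := nextP 0; apply: le.
have [le_gi le] := nextP (g i).+1; apply: le.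
by apply: leq_trans (ltnW lt_ij); exact: le_gi.
Qed.

Lemma has_monotone_subseqs_prod T T1 T2 (p1 : T -> T1) (p2 : T -> T2) R1 R2 :
  has_monotone_subseqs R1 -> has_monotone_subseqs R2 ->
  has_monotone_subseqs (fun x y => R1 (p1 x) (p1 y) /\ R2 (p2 x) (p2 y)).
Proof.
move=> w1 w2 f; have [g gS gR] := w1 (p1 \o f).
have [h hS hR] := w2 (p2 \o f \o g).
exists (g \o h) => [i|i j ij] /=; first exact/increasing_seq_lt/hS.
by split; [apply/gR/increasing_seq_lt | exact: hR].
Qed.

Inductive embeds T (R : T -> T -> Prop) : seq T -> seq T -> Prop :=
| embeds_nil : embeds R [::] [::]
| embeds_skip a u v of embeds R u v : embeds R u (a :: v)
| embeds_cons a b u v of R a b & embeds R u v : embeds R (a :: u) (b :: v).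

Lemma embeds0s T (R : T -> T -> Prop) v : embeds R [::] v.
Proof. by elim: v => [|a v IH]; [exact: embeds_nil | exact: embeds_skip]. Qed.

(** Higman's lemma, by the argument of Nash-Williams: among the sequences without
    i < j such that the i-th word embeds into the j-th, one chooses the words
    successively of least length; removing first letters along a subsequence on
    which these increase then gives a smaller sequence of the same kind. *)
Theorem higman T (R : T -> T -> Prop) (f : nat -> seq T) :
  has_monotone_subseqs R -> exists i j, i < j /\ embeds R (f i) (f j).
Proof.
move=> wR; apply: contrapT => badf.
pose bad (f : nat -> seq T) := forall i j, i < j -> ~ embeds R (f i) (f j).
pose extends (l : seq (seq T)) :=
  exists2 h, bad h & forall i, i < size l -> h i = nth [::] l i.
have nextP l : exists w, extends l -> extends (rcons l w) /\
    forall w', extends (rcons l w') -> size w <= size w'.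
  have [[h badh hl]|nl] := pselect (extends l); last by exists [::] => /nl.
  have ext0 : extends (rcons l (h (size l))).
    exists h => // i; rewrite size_rcons ltnS nth_rcons leq_eqVlt.
    by case: eqP => [-> _|_ /= il]; [rewrite ltnn | rewrite il hl].
  have exk : exists k, `[< exists2 w, extends (rcons l w) & size w = k >].
    by exists (size (h (size l))); apply/asboolP; exists (h (size l)).
  case: (ex_minnP exk) => k /asboolP[w extw <-] kmin.
  exists w => _; split=> // w' extw'.
  by apply: kmin; apply/asboolP; exists w'.
have [next {}nextP] := choice nextP.
pose pre := fix pre n := if n is m.+1 then rcons (pre m) (next (pre m)) else [::].
pose w n := next (pre n).
have size_pre n : size (pre n) = n by elim: n => //= n; rewrite size_rcons => ->.
have nth_pre n i : i < n -> nth [::] (pre n) i = w i.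
  elim: n => // n IH; rewrite ltnS /= nth_rcons size_pre leq_eqVlt.
  by case: eqP => [-> _|_ /= lt_in]; [rewrite ltnn | rewrite lt_in IH].
have ext_pre n : extends (pre n).
  elim: n => [|n /nextP[]//]; exists f => // i j ij emb.
  by apply: badf; exists i, j.
have wbad : bad w.
  move=> i j ij; have [h badh hw] := ext_pre j.+1.
  rewrite -(nth_pre j.+1 i) ?(ltn_trans ij) // -(nth_pre j.+1 j) //.
  by rewrite -!hw ?size_pre ?ltnS ?(ltnW ij) //; exact: badh.
have w_cons n : exists aw : T * seq T, w n = aw.1 :: aw.2.
  case E: (w n) => [|a u]; last by exists (a, u).
  by case: (wbad n n.+1); rewrite // E; exact: embeds0s.
have [aw awE] := choice w_cons.
have [g gS gR] := wR (fst \o aw).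
(* Replacing w from g 0 on by the tails of its g-subsequence stays bad, and
   the entry at g 0 gets shorter. *)
pose h n := if n < g 0 then w n else (aw (g (n - g 0))).2.
have tail_emb v n : embeds R v (aw n).2 -> embeds R v (w n).
  by rewrite awE; exact: embeds_skip.
have hbad : bad h.
  move=> i j ij; rewrite /h; case: (ltnP j (g 0)) => [gj|gj].
    by rewrite (ltn_trans ij gj); exact: wbad.
  case: (ltnP i (g 0)) => [gi|gi] emb.
    apply: (wbad i (g (j - g 0))); last exact: tail_emb.
    apply: leq_trans gi _; case: (j - g 0) => // k.
    exact/ltnW/(increasing_seq_lt gS).
  have lt_ij : i - g 0 < j - g 0 by lia.
  apply: (wbad _ _ (increasing_seq_lt gS lt_ij)); rewrite !awE.
  by apply: embeds_cons => //; exact: gR.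
have [_ /(_ (aw (g 0)).2)] := nextP (pre (g 0)) (ext_pre _).
rewrite -[next _]/(w (g 0)) awE /= ltnn => wmin; suff /wmin : extends
  (rcons (pre (g 0)) (aw (g 0)).2) by [].
exists h => // i; rewrite size_rcons size_pre ltnS nth_rcons size_pre /h leq_eqVlt.
by case: eqP => [-> _|_ /= lt_i]; [rewrite ltnn subnn | rewrite lt_i nth_pre].
Qed.

End WellQuasiOrders.

(** * Downward closed languages *)

Section Letters.
Variable c : nat.
Local Open Scope nat_scope.

Definition letter_le (a b : c.-tuple nat) := forall i, tnth a i <= tnth b i.

End Letters.

Lemma letter_le_cons c k l (a b : c.-tuple nat) :
  letter_le (cons_tuple k a) (cons_tuple l b) <-> (k <= l)%N /\ letter_le a b.
Proof.
split=> [le|[kl le] i]; last first.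
  by case: (unliftP ord0 i) => [j|] ->; rewrite ?tnth0 ?tnthS.
split=> [|i]; first by have := le ord0; rewrite !tnth0.
by have := le (lift ord0 i); rewrite !tnthS.
Qed.

Lemma behead_cons_tuple T c (x : T) (a : c.-tuple T) :
  [tuple of behead (cons_tuple x a)] = a.
Proof. exact/val_inj. Qed.

(** Dickson's lemma, one coordinate at a time. *)
Lemma letter_has_monotone_subseqs c : has_monotone_subseqs (@letter_le c).
Proof.
elim: c => [|c IH].
  by move=> f; exists id => // i j _ [].
have := has_monotone_subseqs_prod (@thead c _) (fun a => [tuple of behead a])
  leq_has_monotone_subseqs IH.
move=> w f; have [g gS gR] := w f; exists g => // i j /gR.
case/tupleP: (f (g i)) => k a; case/tupleP: (f (g j)) => l b.
by rewrite !theadE !behead_cons_tuple letter_le_cons.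
Qed.

Definition chains_stationary T (P : set T -> Prop) :=
  forall D : nat -> set T, (forall n, P (D n)) -> (forall n, D n.+1 `<=` D n) ->
  exists N, forall n, (N <= n)%N -> D n = D N.

Section Downsets.
Variable c : nat.
Notation letter := (c.-tuple nat).
Notation word := (seq letter).
Implicit Types (D E : set word) (a b : letter).

Definition downset D := forall u v, embeds (@letter_le c) u v -> D v -> D u.

Definition left_quotient D a : set word := fun w => D (a :: w).

Lemma embeds_refl (u : word) : embeds (@letter_le c) u u.
Proof. by elim: u => [|a u]; [exact: embeds_nil | exact: embeds_cons]. Qed.

Lemma left_quotient_downset D a : downset D -> downset (left_quotient D a).
Proof. by move=> dD u v uv; apply: dD; exact: embeds_cons. Qed.

Lemma left_quotient_sub D a : downset D -> left_quotient D a `<=` D.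
Proof. by move=> dD w; apply: dD; apply: embeds_skip; exact: embeds_refl. Qed.

Lemma left_quotient_antitone D a b : downset D -> letter_le a b ->
  left_quotient D b `<=` left_quotient D a.
Proof. by move=> dD ab w; apply: dD; apply: embeds_cons => //; exact: embeds_refl. Qed.

(** If a chain never stabilizes, then words that leave it one after the other
    contradict Higman's lemma. *)
Lemma downset_stationary : chains_stationary downset.
Proof.
move=> D dD DS; have Dle m n : (m <= n)%N -> D n `<=` D m.
  elim: n => [|n IH]; first by rewrite leqn0 => /eqP->.
  rewrite leq_eqVlt => /orP[/eqP->//|/IH].
  exact: subset_trans (DS n).
apply: contrapT => notN.
have leaveP N : exists nw : nat * word, [/\ (N <= nw.1)%N, D N nw.2 & ~ D nw.1 nw.2].
  apply: contrapT => nowN; apply: notN; exists N => n Nn.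
  apply/seteqP; split=> [|w DNw]; first exact: Dle.
  by apply: contrapT => nDw; apply: nowN; exists (n, w).
have [nw nwP] := choice leaveP.
pose g := fix g i := if i is i'.+1 then (nw (g i')).1 else 0%N.
have gle i j : (i <= j)%N -> (g i <= g j)%N.
  elim: j => [|j IH]; first by case: i.
  rewrite leq_eqVlt => /orP[/eqP->//|/IH]/leq_trans; apply.
  by case: (nwP (g j)).
have [i [j [ij emb]]] := higman (fun i => (nw (g i)).2)
  (@letter_has_monotone_subseqs c).
case: (nwP (g i)) => _ _; apply; case: (nwP (g j)) => _ Dj _.
by apply: (dD _ _ _ emb); apply: (Dle _ _ (gle i.+1 j ij)).
Qed.

(** Noetherian induction: a minimal counterexample exists, since choosing ever
    smaller ones would give a chain that is not stationary. *)
Lemma downset_ind (P : set word -> Prop) :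
  (forall D, downset D ->
     (forall E, downset E -> E `<=` D -> E <> D -> P E) -> P D) ->
  forall D, downset D -> P D.
Proof.
move=> step D0 dD0; apply: contrapT => nP0.
pose bad D := downset D /\ ~ P D.
have nextP D : exists E, bad D -> [/\ bad E, E `<=` D & E <> D].
  have [[dD nPD]|nb] := pselect (bad D); last by exists D => /nb.
  apply: contrapT => noE; apply: nPD; apply: step => // E dE sE nE.
  by apply: contrapT => nPE; apply: noE; exists E.
have [next {}nextP] := choice nextP.
have badn n : bad (iter n next D0) by elim: n => //= n /nextP[].
have [N stN] := downset_stationary (fun n => (badn n).1)
  (fun n => let: And3 _ s _ := nextP _ (badn n) in s).
by have [_ _] := nextP _ (badn N); apply; have := stN N.+1 (leqnSn N).
Qed.

End Downsets.

(** * Functions of a letter with eventually constant slices *)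

Section Slices.
Variable V : Type.

Definition slice c (phi : c.+1.-tuple nat -> V) k (a : c.-tuple nat) :=
  phi (cons_tuple k a).

(** Tameness is hereditary in the slices, so that sums over letters can be
    computed one coordinate at a time. *)
Fixpoint tame c : (c.-tuple nat -> V) -> Prop :=
  if c is c'.+1 then fun phi =>
    (exists N, forall k, (N <= k)%N -> slice phi k = slice phi N) /\
    forall k, tame (slice phi k)
  else fun=> True.

End Slices.

Definition antitone T c (phi : c.-tuple nat -> set T) :=
  forall a b, letter_le a b -> phi b `<=` phi a.

(** In several variables the diagonal does the work: where the diagonal slices
    are constant from N on, so are all slices with both indices at least N,
    and only finitely many values of the second index remain. *)
Lemma antitone_slices_stationary T (P : set T -> Prop) :
  chains_stationary P ->
  forall c (phi : c.+1.-tuple nat -> set T), (forall a, P (phi a)) ->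
  antitone phi -> exists N, forall k, (N <= k)%N -> slice phi k = slice phi N.
Proof.
move=> dcc; elim=> [|c IH] phi Pphi aphi.
  have [n||N stN] := dcc (fun k => phi (cons_tuple k [tuple])).
  - exact: Pphi.
  - by move=> n; apply: aphi; apply/letter_le_cons; split.
  by exists N => k /stN E; apply/funext => a; rewrite (tuple0 a) /slice E.
pose diag (b : c.+1.-tuple nat) := phi (cons_tuple (thead b) b).
have [b||N stN] := IH diag.
- exact: Pphi.
- move=> a b; case/tupleP: a => k a; case/tupleP: b => l b ab.
  apply: aphi; apply/letter_le_cons; rewrite !theadE; split=> //.
  by case/letter_le_cons: ab.
have slice2P l : exists M, forall k, (M <= k)%N ->
    forall a, slice phi k (cons_tuple l a) = slice phi M (cons_tuple l a).
  have [b||M stM] := IH (fun b => phi (cons_tuple (thead b)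
    (cons_tuple l [tuple of behead b]))).
  - exact: Pphi.
  - move=> a b; case/tupleP: a => i a; case/tupleP: b => j b /letter_le_cons[ij ab].
    apply: aphi; rewrite !theadE !letter_le_cons; split=> //; split=> // h.
    by have := ab h; rewrite !(tnth_nth 0%N).
  exists M => k /stM E a; have := congr1 (@^~ a) E; rewrite /slice !theadE.
  by rewrite !behead_cons_tuple.
have [M MP] := choice slice2P.
pose N' := maxn N (\max_(l < N) M l).
exists N' => k N'k; apply/funext => b; case/tupleP: b => l a.
case: (ltnP l N) => [lN|Nl].
  have Ml : (M l <= N')%N.
    by rewrite leq_max (leq_bigmax (Ordinal lN)) orbT.
  by rewrite (MP l k (leq_trans Ml N'k)) (MP l N' Ml).
have diagE n : (N <= n)%N -> phi (cons_tuple n (cons_tuple n a)) =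
    phi (cons_tuple N (cons_tuple N a)).
  by move=> /stN/(congr1 (@^~ a)); rewrite /slice /diag !theadE.
suff sliceE n : (N <= n)%N -> slice phi n (cons_tuple l a) =
    phi (cons_tuple N (cons_tuple N a)).
  by rewrite !sliceE ?leq_maxl // (leq_trans _ N'k) ?leq_maxl.
move=> Nn; apply/seteqP; split.
  by apply: aphi; rewrite !letter_le_cons; do !split.
rewrite -(diagE (maxn n l)) ?leq_max ?Nn //.
by apply: aphi; rewrite !letter_le_cons leq_maxl leq_maxr; do !split.
Qed.

Lemma antitone_tame T (P : set T -> Prop) :
  chains_stationary P ->
  forall c (phi : c.-tuple nat -> set T), (forall a, P (phi a)) ->
  antitone phi -> tame phi.
Proof.
move=> dcc; elim=> //= c IH phi Pphi aphi.
split=> [|k]; first exact: (antitone_slices_stationary dcc Pphi aphi).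
apply: IH => [a|a b ab]; first exact: Pphi.
by apply: aphi; apply/letter_le_cons; rewrite leqnn; split.
Qed.

Lemma left_quotient_tame c (D : set (seq (c.-tuple nat))) : downset D -> tame (left_quotient D).
Proof.
move=> dD; apply: (antitone_tame (@downset_stationary c)) => [a|a b].
  exact: left_quotient_downset.
exact: left_quotient_antitone.
Qed.

(** * Formal power series *)

Definition pseries (R : Type) := nat -> R.

Section PowerSeriesRing.
Variable R : comNzRingType.
Implicit Types A B C : pseries R.

HB.instance Definition _ := gen_eqMixin (pseries R).
HB.instance Definition _ := gen_choiceMixin (pseries R).

Definition ps_zero : pseries R := fun=> 0.
Definition ps_opp A : pseries R := fun n => - A n.
Definition ps_add A B : pseries R := fun n => A n + B n.
Definition ps_one : pseries R := fun n => (n == 0)%:R.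
Definition ps_mul A B : pseries R := fun n => \sum_(i < n.+1) A i * B (n - i)%N.

Fact ps_addA : associative ps_add.
Proof. by move=> A B C; apply/funext => n; exact: addrA. Qed.
Fact ps_addC : commutative ps_add.
Proof. by move=> A B; apply/funext => n; exact: addrC. Qed.
Fact ps_add0 : left_id ps_zero ps_add.
Proof. by move=> A; apply/funext => n; exact: add0r. Qed.
Fact ps_addN : left_inverse ps_zero ps_opp ps_add.
Proof. by move=> A; apply/funext => n; exact: addNr. Qed.

HB.instance Definition _ :=
  GRing.isZmodule.Build (pseries R) ps_addA ps_addC ps_add0 ps_addN.

Fact ps_mulC : commutative ps_mul.
Proof.
move=> A B; apply/funext => n; rewrite /ps_mul (reindex_inj rev_ord_inj) /=.
apply: eq_bigr => i _; rewrite mulrC; congr (B _ * A _); rewrite subSS ?subKn //.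
by rewrite -ltnS.
Qed.

(** Each coefficient of a product is that of a product of truncations to
    polynomials, so associativity is inherited from polynomials. *)
Fact ps_mulA : associative ps_mul.
Proof.
move=> A B C; apply/funext => n.
pose tr (A : pseries R) : {poly R} := \poly_(i < n.+1) A i.
have trE D i : (i <= n)%N -> (tr D)`_i = D i by rewrite coef_poly ltnS => ->.
have trM D E i : (i <= n)%N -> ps_mul D E i = (tr D * tr E)`_i.
  move=> le_in; rewrite coefM; apply: eq_bigr => k _.
  by rewrite !trE ?(leq_trans (leq_subr _ _)) // (leq_trans _ le_in) // -ltnS.
transitivity (tr A * tr B * tr C)`_n.
  rewrite -mulrA [RHS]coefM; apply: eq_bigr => k _.
  by rewrite trE ?trM ?leq_subr // -ltnS.
rewrite coefM; apply: eq_bigr => k _.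
by rewrite trM ?trE ?leq_subr // -ltnS.
Qed.

Fact ps_mul1 : left_id ps_one ps_mul.
Proof.
move=> A; apply/funext => n; rewrite /ps_mul big_ord_recl subn0 mul1r.
by rewrite big1 ?addr0 // => i _; rewrite mul0r.
Qed.

Fact ps_mulDl : left_distributive ps_mul ps_add.
Proof.
move=> A B C; apply/funext => n; rewrite /ps_mul /ps_add -big_split /=.
by apply: eq_bigr => i _; rewrite mulrDl.
Qed.

Fact ps_one_neq0 : ps_one != 0.
Proof. by apply/eqP => /(congr1 (@^~ 0%N))/eqP; rewrite oner_eq0. Qed.

HB.instance Definition _ := GRing.Zmodule_isComNzRing.Build (pseries R)
  ps_mulA ps_mulC ps_mul1 ps_mulDl ps_one_neq0.

Lemma ps_addE A B n : (A + B) n = A n + B n.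
Proof. by []. Qed.

Lemma ps_mulE A B n : (A * B) n = \sum_(i < n.+1) A i * B (n - i)%N.
Proof. by []. Qed.

Lemma ps_sumE I (r : seq I) (F : I -> pseries R) n :
  (\sum_(i <- r) F i) n = \sum_(i <- r) F i n.
Proof. by elim/big_rec2: _ => // i x y _ <-. Qed.

End PowerSeriesRing.

Notation series := (pseries (pseries int)).

Definition ser_of_poly (P : {poly {poly int}}) : series := fun n j => P`_n`_j.

Fact ser_of_poly_zmod : zmod_morphism ser_of_poly.
Proof.
by move=> P Q; apply/funext => n; apply/funext => j; rewrite /ser_of_poly !coefB.
Qed.

Fact ser_of_poly_monoid : monoid_morphism ser_of_poly.
Proof.
split=> [|P Q]; apply/funext => n; apply/funext => j.
  by rewrite /ser_of_poly coef1; case: n => [|n]; rewrite ?coef1 ?coef0.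
rewrite /ser_of_poly coefM coef_sum ps_mulE ps_sumE.
by apply: eq_bigr => i _; rewrite coefM.
Qed.

HB.instance Definition _ := GRing.isZmodMorphism.Build {poly {poly int}} series
  ser_of_poly ser_of_poly_zmod.
HB.instance Definition _ := GRing.isMonoidMorphism.Build {poly {poly int}} series
  ser_of_poly ser_of_poly_monoid.

Lemma ser_polyD P Q : ser_of_poly (P + Q) = ser_of_poly P + ser_of_poly Q.
Proof. exact: rmorphD. Qed.

Lemma ser_polyM P Q : ser_of_poly (P * Q) = ser_of_poly P * ser_of_poly Q.
Proof. exact: rmorphM. Qed.

Lemma ser_polyB P Q : ser_of_poly (P - Q) = ser_of_poly P - ser_of_poly Q.
Proof. exact: rmorphB. Qed.

Lemma ser_poly1 : ser_of_poly 1 = 1.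
Proof. exact: rmorph1. Qed.

Lemma series2_mulE (A B : series) : series2_mul A B = A * B.
Proof. by apply/funext => n; apply/funext => j; rewrite ps_mulE ps_sumE. Qed.

Notation ser_s := (ser_of_poly 'X).
Notation ser_t := (ser_of_poly 'X%:P).

Lemma ser_sM (A : series) n j : (ser_s * A) n j = if n is m.+1 then A m j else 0.
Proof.
rewrite ps_mulE ps_sumE; case: n => [|n].
  by rewrite big_ord1 ps_mulE big1 // => i _; rewrite /ser_of_poly coefX coef0 mul0r.
rewrite big_ord_recl big_ord_recl /= big1 => [|i _]; last first.
  by rewrite ps_mulE big1 // => k _; rewrite /ser_of_poly coefX coef0 mul0r.
rewrite ps_mulE big1 => [|i _]; last by rewrite /ser_of_poly coefX coef0 mul0r.
rewrite add0r addr0 ps_mulE big_ord_recl big1 => [|i _]; last first.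
  by rewrite /ser_of_poly coefX coef1 mul0r.
by rewrite /ser_of_poly coefX coef1 mul1r addr0 subn1 subn0.
Qed.

Lemma ser_tM (A : series) n j : (ser_t * A) n j = if j is k.+1 then A n k else 0.
Proof.
rewrite ps_mulE ps_sumE big_ord_recl /= big1 => [|i _]; last first.
  by rewrite ps_mulE big1 // => k _; rewrite /ser_of_poly coefC coef0 mul0r.
rewrite addr0 ps_mulE subn0; case: j => [|j].
  by rewrite big_ord1 /ser_of_poly coefC coefX mul0r.
rewrite big_ord_recl big_ord_recl /= big1 => [|i _]; last first.
  by rewrite /ser_of_poly coefC coefX mul0r.
by rewrite /ser_of_poly coefC !coefX mul0r mul1r add0r addr0 subn1.
Qed.

(** * Sums weighted by powers of t *)

(** The series sum_k t^k (G k). *)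
Definition geom_sum (G : nat -> series) : series :=
  fun n j => \sum_(k < j.+1) G k n (j - k)%N.

Lemma geom_sum_rec G : geom_sum G = G 0%N + ser_t * geom_sum (fun k => G k.+1).
Proof.
apply/funext => n; apply/funext => j; rewrite !ps_addE ser_tM /geom_sum.
rewrite big_ord_recl subn0; congr (_ + _); case: j => [|j]; first by rewrite big_ord0.
by apply: eq_bigr => k _; rewrite subSS.
Qed.

(** Solutions of this recursion are unique because each unfolding gains a
    factor t. *)
Lemma geom_sum_unique (Y G : nat -> series) :
  (forall i, Y i = G i + ser_t * Y i.+1) -> Y 0%N = geom_sum G.
Proof.
move=> YG; suff YE j i n : Y i n j = geom_sum (fun k => G (i + k)%N) n j.
  by apply/funext => n; apply/funext => j; rewrite YE.
elim: j i => [|j IH] i; rewrite YG geom_sum_rec !ps_addE !ser_tM addn0 // IH.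
by congr (_ + geom_sum _ _ _); apply/funext => k; rewrite addnS.
Qed.

Lemma geom_sum_const A : geom_sum (fun=> A) = A + ser_t * geom_sum (fun=> A).
Proof. exact: geom_sum_rec. Qed.

Lemma geom_sumD G H : geom_sum (fun k => G k + H k) = geom_sum G + geom_sum H.
Proof.
by apply/funext => n; apply/funext => j; rewrite !ps_addE -big_split.
Qed.

Lemma geom_sumM G B : geom_sum (fun k => G k * B) = geom_sum G * B.
Proof.
have shift i : (fun k => G (i.+1 + k)%N) = (fun k => G (i + k.+1)%N).
  by apply/funext => k; rewrite addnS.
rewrite -(geom_sum_unique (Y := fun i => geom_sum (fun k => G (i + k)%N) * B)) // => i.
by rewrite [X in X * B]geom_sum_rec addn0 shift mulrDl mulrA.
Qed.

(** The sum of t^|a| (F a) over all letters a, where |a| is the sum of the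
    entries of a. *)
Fixpoint letter_sum c : (c.-tuple nat -> series) -> series :=
  if c is c'.+1 then fun F => geom_sum (fun k => letter_sum (slice F k))
  else fun F => F [tuple].

Lemma letter_sumD c (F G : c.-tuple nat -> series) :
  letter_sum (fun a => F a + G a) = letter_sum F + letter_sum G.
Proof.
elim: c F G => //= c IH F G; rewrite -geom_sumD; congr geom_sum.
by apply/funext => k; rewrite -IH.
Qed.

Lemma letter_sumM c (F : c.-tuple nat -> series) B :
  letter_sum (fun a => F a * B) = letter_sum F * B.
Proof.
elim: c F => //= c IH F; rewrite -geom_sumM; congr geom_sum.
by apply/funext => k; rewrite -IH.
Qed.

(** A tame sum is built by finitely many steps A + t B and geometric series
    A / (1 - t); the index of Q counts the latter. *)
Lemma letter_sum_ind V (Q : nat -> series -> Prop) (G : V -> series) :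
  (forall c A B, Q c A -> B = A + ser_t * B -> Q c.+1 B) ->
  (forall c A B, Q c A -> Q c.+1 B -> Q c.+1 (A + ser_t * B)) ->
  forall c (phi : c.-tuple nat -> V), tame phi ->
  (forall a, Q 0%N (G (phi a))) -> Q c (letter_sum (G \o phi)).
Proof.
move=> Qgeom Qstep; elim=> [|c IH] phi; first by move=> _; apply.
move=> /= [[N stN] tphi] Q0.
have Qslice k : Q c (letter_sum (slice (G \o phi) k)).
  by apply: (IH (slice phi k)) => // a; exact: Q0.
have {}stN k : (N <= k)%N -> letter_sum (slice (G \o phi) k) =
    letter_sum (slice (G \o phi) N).
  move=> /stN E; congr letter_sum; apply/funext => a.
  exact: (congr1 (fun f => G (f a)) E).
suff Qstat F : (forall k, Q c (F k)) -> (forall k, (N <= k)%N -> F k = F N) ->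
  Q c.+1 (geom_sum F) by exact: Qstat.
elim: N F {stN} => [|N IHN] F QF stF; last first.
  rewrite geom_sum_rec; apply: Qstep => //.
  by apply: (IHN (fun k => F k.+1)) => [k|k Nk]; [exact: QF | exact: stF].
have -> : F = fun=> F 0%N by apply/funext => k; exact: stF.
exact: Qgeom (QF 0%N) (geom_sum_const _).
Qed.

(** * Rational series with the prescribed denominators *)

(** The products of factors 1 - t and (1 - t)^e - s f with e at most c and
    f(1) > 0 form a multiplicative set; the series below are the elements of
    the localization of Z[s,t] at that set. *)
Definition denom a (l : seq (nat * {poly int})) : {poly {poly int}} :=
  (1 - 'X%:P) ^+ a * \prod_(x <- l) ((1 - 'X%:P) ^+ x.1 - 'X * x.2%:P).

Definition denom_factors c (l : seq (nat * {poly int})) :=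
  forall x, x \in l -> (x.1 <= c)%N /\ 0 < x.2.[1].

Definition rational_series c (A : series) := exists a l g,
  denom_factors c l /\ A * ser_of_poly (denom a l) = ser_of_poly g.

Lemma denomM a l a' l' : denom a l * denom a' l' = denom (a + a') (l ++ l').
Proof. by rewrite /denom big_cat exprD /=; ring. Qed.

Lemma ser_denom_cat a l a' l' : ser_of_poly (denom (a + a') (l ++ l')) =
  ser_of_poly (denom a l) * ser_of_poly (denom a' l').
Proof. by rewrite -denomM ser_polyM. Qed.

Lemma denom_factors_cat c l l' :
  denom_factors c l -> denom_factors c l' -> denom_factors c (l ++ l').
Proof. by move=> hl hl' x; rewrite mem_cat => /orP[/hl|/hl']. Qed.

Lemma rational_poly c g : rational_series c (ser_of_poly g).
Proof.
exists 0%N, [::], g; split=> //.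
by rewrite /denom big_nil expr0 mulr1 ser_poly1 mulr1.
Qed.

Lemma rationalD c A B :
  rational_series c A -> rational_series c B -> rational_series c (A + B).
Proof.
move=> [a [l [g [hl E]]]] [a' [l' [g' [hl' E']]]].
exists (a + a')%N, (l ++ l'), (g * denom a' l' + g' * denom a l).
split; first exact: denom_factors_cat.
by rewrite ser_denom_cat ser_polyD (ser_polyM g) (ser_polyM g') -E -E'; ring.
Qed.

Lemma rationalM c A B :
  rational_series c A -> rational_series c B -> rational_series c (A * B).
Proof.
move=> [a [l [g [hl E]]]] [a' [l' [g' [hl' E']]]].
exists (a + a')%N, (l ++ l'), (g * g').
split; first exact: denom_factors_cat.
by rewrite ser_denom_cat ser_polyM -E -E'; ring.
Qed.

Lemma rational_denomI c a l A : denom_factors c l ->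
  rational_series c (ser_of_poly (denom a l) * A) -> rational_series c A.
Proof.
move=> hl [a' [l' [g [hl' E]]]]; exists (a + a')%N, (l ++ l'), g.
split; first exact: denom_factors_cat.
by rewrite ser_denom_cat -E; ring.
Qed.

Lemma rational_letter_sum V (G : V -> series) c0 c (phi : c.-tuple nat -> V) :
  tame phi -> (forall a, rational_series c0 (G (phi a))) ->
  rational_series c0 (letter_sum (G \o phi)).
Proof.
apply: (letter_sum_ind (Q := fun=> rational_series c0)) => [_ A B ratA EB|_ A B ratA ratB].
  apply: (@rational_denomI c0 1 [::]) => //; rewrite /denom big_nil expr1 mulr1.
  by rewrite ser_polyB ser_poly1 mulrBl mul1r {1}EB addrK.
by apply: rationalD => //; apply: rationalM => //; exact: rational_poly.
Qed.

(** The shape of the generating function of a set of letters, which is 0 only for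
    the empty set. *)
Definition positive_fraction c (A : series) := A = 0 \/ exists d (p : {poly int}),
  [/\ (d <= c)%N, 0 < p.[1] & ser_of_poly ((1 - 'X%:P) ^+ d) * A = ser_of_poly p%:P].

Lemma positive_fraction_widen c A :
  positive_fraction c A -> positive_fraction c.+1 A.
Proof.
by case=> [->|[d [p [dc p1 E]]]]; [left | right; exists d, p; rewrite leqW].
Qed.

(** Over the common denominator only the summands with a pole of maximal order
    contribute to the value of the numerator at t = 1, and they contribute
    positively. *)
Lemma positive_fractionD c A B :
  positive_fraction c A -> positive_fraction c B -> positive_fraction c (A + B).
Proof.
case=> [->|[d [p [dc p1 E]]]]; first by rewrite add0r.
case=> [->|[d' [p' [dc' p1' E']]]]; first by rewrite addr0; right; exists d, p.
right; exists (maxn d d'), ((1 - 'X) ^+ (d' - d) * p + (1 - 'X) ^+ (d - d') * p').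
split; first by rewrite geq_max dc.
  rewrite !(hornerE, horner_exp) subrr !expr0n !subn_eq0.
  by case: ltngtP => _; rewrite ?mul0r ?mul1r ?add0r ?addr0 // addr_gt0.
have shift e (q : {poly int}) : ((1 - 'X) ^+ e * q)%:P = (1 - 'X%:P) ^+ e * q%:P.
  by rewrite rmorphM rmorphXn rmorphB rmorph1.
have expand k e C : (k <= maxn d d')%N -> e = (maxn d d' - k)%N ->
    ser_of_poly ((1 - 'X%:P) ^+ maxn d d') * C =
    ser_of_poly ((1 - 'X%:P) ^+ e) * (ser_of_poly ((1 - 'X%:P) ^+ k) * C).
  by move=> le ->; rewrite mulrA -ser_polyM -exprD subnK.
have ed : (d' - d = maxn d d' - d)%N by lia.
have ed' : (d - d' = maxn d d' - d')%N by lia.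
rewrite mulrDr (expand d _ A (leq_maxl _ _) ed) (expand d' _ B (leq_maxr _ _) ed').
by rewrite E E' polyCD !shift ser_polyD !ser_polyM.
Qed.

Lemma positive_fraction_tM c A :
  positive_fraction c A -> positive_fraction c (ser_t * A).
Proof.
case=> [->|[d [p [dc p1 E]]]]; first by left; rewrite mulr0.
right; exists d, ('X * p); split=> //; first by rewrite hornerM hornerX mul1r.
by rewrite mulrCA E polyCM ser_polyM.
Qed.

Lemma positive_fraction_letter_sum V (P : V -> bool) c (phi : c.-tuple nat -> V) :
  tame phi -> positive_fraction c (letter_sum (fun a => (P (phi a))%:R)).
Proof.
move=> tphi; apply: (letter_sum_ind (Q := positive_fraction)
  (G := fun v => (P v)%:R) _ _ tphi) => [d A B|d A B|a].
- case=> [->|[e [p [ed p1 E]]]] EB.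
    left; apply/funext => n; apply/funext => j.
    by elim: j => [|j IH]; rewrite EB add0r ser_tM.
  right; exists e.+1, p; split=> //.
  rewrite exprSr ser_polyM -mulrA -E; congr (_ * _).
  by rewrite ser_polyB ser_poly1 mulrBl mul1r {1}EB addrK.
- move=> /positive_fraction_widen wA wB.
  by apply: positive_fractionD => //; exact: positive_fraction_tM.
- case: (P _); [right | by left].
  by exists 0%N, 1; rewrite hornerE expr0 mulr1 polyC1 ltr01.
Qed.

(** This solves B = s A B + R for B: multiplied by the denominator of A, the
    factor 1 - s A becomes one of the factors allowed in denominators. *)
Lemma rational_solve c A B : positive_fraction c A ->
  rational_series c (B - ser_s * A * B) -> rational_series c B.
Proof.
case=> [->|[d [p [dc p1 E]]] ratB]; first by rewrite mulr0 mul0r subr0.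
apply: (@rational_denomI c 0 [:: (d, p)]) => [x|].
  by rewrite inE => /eqP->.
have -> : ser_of_poly (denom 0 [:: (d, p)]) * B =
    ser_of_poly ((1 - 'X%:P) ^+ d) * (B - ser_s * A * B).
  rewrite /denom big_seq1 expr0 mul1r ser_polyB ser_polyM -E /=; ring.
by apply: rationalM => //; exact: rational_poly.
Qed.

(** * The generating function of a downward closed language *)

Section Words.
Variable c : nat.
Notation letter := (c.-tuple nat).
Notation word := (seq letter).

(** The concatenation of the lists F a (j - |a|) over all letters a. *)
Fixpoint letter_flatten T d : (d.-tuple nat -> nat -> seq T) -> nat -> seq T :=
  if d is d'.+1 then fun F j =>
    [seq x | k <- iota 0 j.+1, x <- letter_flatten (slice F k) (j - k)]
  else fun F => F [tuple].

Lemma letter_flattenS T d (F : d.+1.-tuple nat -> nat -> seq T) j :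
  letter_flatten F j =
  [seq x | k <- iota 0 j.+1, x <- letter_flatten (slice F k) (j - k)].
Proof. by []. Qed.

Lemma mem_letter_flatten (T : eqType) d (F : d.-tuple nat -> nat -> seq T) j x :
  x \in letter_flatten F j <->
  exists2 a : d.-tuple nat, (sumn a <= j)%N & x \in F a (j - sumn a)%N.
Proof.
elim: d F j x => [|d IH] F j x.
  split=> [xF|[a _]]; first by exists [tuple]; rewrite // subn0.
  by rewrite (tuple0 a) subn0.
rewrite letter_flattenS; split=> [/allpairsPdep[k [y [+ + ->]]]|[a]].
  rewrite mem_iota add0n ltnS => kj /IH[a aj xF]; exists (cons_tuple k a) => /=.
    by rewrite -(subnKC kj) leq_add2l.
  by rewrite subnDA.
case/tupleP: a => k a kaj xF; rewrite /= in kaj xF; apply/allpairsPdep; exists k, x.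
have kj : (k <= j)%N by apply: leq_trans kaj; rewrite leq_addr.
split=> //; first by rewrite mem_iota add0n ltnS.
by apply/IH; exists a; rewrite -?subnDA // -(leq_add2l k) subnKC.
Qed.

Lemma letter_flatten_uniq (T : eqType) d (F : d.-tuple nat -> nat -> seq T) j :
  (forall a i, uniq (F a i)) ->
  (forall a b i k x, x \in F a i -> x \in F b k -> a = b) ->
  uniq (letter_flatten F j).
Proof.
elim: d F j => [|d IH] F j uF injF; first exact: uF.
rewrite letter_flattenS.
apply: allpairs_uniq_dep; first exact: iota_uniq.
  move=> k _; apply: IH => [a i|a b i l x xa xb]; first exact: uF.
  by have [] := congr1 val (injF _ _ _ _ _ xa xb) => /val_inj.
move=> _ _ /allpairsPdep[k [x [_ xF ->]]] /allpairsPdep[l [y [_ yF ->]]] /= xy.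
rewrite -{}xy in yF *; have /mem_letter_flatten[a _ xa] := xF.
have /mem_letter_flatten[b _ xb] := yF.
have [kl _] := congr1 val (injF _ _ _ _ _ xa xb).
by rewrite kl.
Qed.

Lemma count_letter_flatten T (p : pred T) d
    (F : nat -> d.-tuple nat -> nat -> seq T) n j :
  (count p (letter_flatten (F n) j))%:Z =
  letter_sum (fun a m i => (count p (F m a i))%:Z) n j.
Proof.
elim: d F j => [|d IH] F j; first by [].
rewrite letter_flattenS count_flatten -map_comp sumnE big_map.
rewrite -[iota 0 _]/(index_iota 0 j.+1) big_mkord /= /geom_sum rmorph_sum.
apply: eq_bigr => k _ /=.
by rewrite map_id (IH (fun m => slice (F m) k)).
Qed.

(** The words of length n and total degree j. *)
Fixpoint words n : nat -> seq word :=
  if n is n'.+1 then letter_flatten (fun a i => [seq a :: w | w <- words n' i])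
  else fun j => if j == 0%N then [:: [::]] else [::].

Definition word_deg (w : word) := (\sum_(a <- w) sumn a)%N.

Lemma mem_words n j w : (w \in words n j) = (size w == n) && (word_deg w == j).
Proof.
elim: n j w => [|n IH] j w.
  rewrite /= size_eq0; case: eqP => [->|nj].
    by rewrite inE; case: eqP => // ->; rewrite /word_deg big_nil.
  by case: eqP => // ->; rewrite /word_deg big_nil eq_sym; case: eqP.
apply/idP/andP => [/mem_letter_flatten[a aj /mapP[u + ->]]|].
  rewrite IH /= /word_deg big_cons => /andP[/eqP-> /eqP->].
  by rewrite subnKC.
case: w => [[]//|a w] [/eqP[nw] /eqP<-]; apply/mem_letter_flatten.
have aw : word_deg (a :: w) = (sumn a + word_deg w)%N by rewrite /word_deg big_cons.
exists a; first by rewrite aw leq_addr.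
by apply: map_f; rewrite IH nw aw addKn !eqxx.
Qed.

Lemma words_uniq n j : uniq (words n j).
Proof.
elim: n j => [|n IH] j; first by rewrite /=; case: ifP.
apply: letter_flatten_uniq => [a i|a b i k x /mapP[u _ ->] /mapP[v _ []] //].
by rewrite map_inj_uniq // => u v [].
Qed.

Definition word_series (D : set word) : series :=
  fun n j => (count (fun w => `[< D w >]) (words n j))%:Z.

Lemma word_series_rec D : word_series D =
  (`[< D [::] >])%:R + ser_s * letter_sum (fun a => word_series (left_quotient D a)).
Proof.
apply/funext => n; apply/funext => j; rewrite !ps_addE ser_sM.
case: n => [|n].
  rewrite addr0 /word_series /=.
  case: j => [|j] /=; case: asboolP => D0 //.
have -> : ((`[< D [::] >])%:R : series) n.+1 j = 0 :> int by case: asboolP.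
rewrite add0r.
rewrite /word_series /= (count_letter_flatten _
  (fun n a i => [seq a :: w | w <- words n i])).
congr (letter_sum _ _ _); apply/funext => a; apply/funext => m; apply/funext => i.
by rewrite count_map.
Qed.

(** Splitting off the first letter a of a word leaves the language left_quotient D a,
    which is either D itself or smaller. The letters of the first kind make up
    the denominator, the others are covered by Noetherian induction. *)
Theorem downset_rational D : downset D -> rational_series c (word_series D).
Proof.
move: D; apply: downset_ind => D dD IH; have tameD := left_quotient_tame dD.
pose stays E := `[< E = D >]; pose A := letter_sum (fun a => (stays (left_quotient D a))%:R).
pose G E := if stays E then 0 else word_series E.
apply: (@rational_solve _ A); first exact: positive_fraction_letter_sum.
have -> : word_series D - ser_s * A * word_series D =
    (`[< D [::] >])%:R + ser_s * letter_sum (G \o left_quotient D).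
  have split_sum : letter_sum (fun a => word_series (left_quotient D a)) =
      A * word_series D + letter_sum (G \o left_quotient D).
    rewrite -letter_sumM -letter_sumD; congr letter_sum; apply/funext => a /=.
    rewrite /G /stays; case: asboolP => [->|_]; first by rewrite mul1r addr0.
    by rewrite mul0r add0r.
  by rewrite {1}word_series_rec split_sum; ring.
apply: rationalD.
  have -> : (`[< D [::] >])%:R = ser_of_poly (`[< D [::] >])%:R by rewrite rmorph_nat.
  exact: rational_poly.
apply: rationalM; first exact: rational_poly.
apply: rational_letter_sum => // a; rewrite /G /stays.
case: asboolP => [_|neD]; first by have := rational_poly c 0; rewrite rmorph0.
by apply: IH => //; [exact: left_quotient_downset | exact: left_quotient_sub].
Qed.

End Words.

(** * Leading monomials *)

Section LeadingMonomials.
Variables (K : fieldType) (n : nat).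
Implicit Types (J : set {mpoly K[n]}) (p q : {mpoly K[n]}) (m : 'X_{1..n}).

Definition leading_monomials J : set 'X_{1..n} :=
  [set m | exists p, [/\ J p, p != 0 & mlead p = m]].

Lemma leading_monomials_up J m m' : graded_ideal J ->
  (m <= m')%MM -> leading_monomials J m -> leading_monomials J m'.
Proof.
case=> _ _ JM _ + [p [Jp p0 pm]]; rewrite -{}pm => mm'.
have X0 : 'X_[(m' - mlead p)] != 0 :> {mpoly K[n]}.
  by apply/eqP => /(congr1 (mcoeff (m' - mlead p))); rewrite mcoeffX eqxx mcoeff0 => /eqP;
     rewrite oner_eq0.
exists ('X_[(m' - mlead p)] * p); split; first exact: JM.
  by rewrite mulf_neq0.
by rewrite mleadM // mleadXm submK.
Qed.

Lemma mcoeff_pihomog d p m : (pihomog mdeg d p)@_m = if mdeg m == d then p@_m else 0.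
Proof.
rewrite pihomogE raddf_sum /=.
have [mp|mp] := boolP (m \in msupp p); last first.
  rewrite (memN_msupp_eq0 mp) if_same big_seq_cond big1 // => k /andP[kp _].
  rewrite mcoeffZ mcoeffX; case: eqP => [km|_]; last by rewrite mulr0.
  by rewrite -km kp in mp.
rewrite big_mkcond (bigD1_seq m) //= big1 ?addr0 => [|k km].
  by case: ifP => _; rewrite ?mcoeff0 ?mcoeffZ ?mcoeffX ?eqxx ?mulr1.
by case: ifP => // _; rewrite mcoeffZ mcoeffX (negbTE km) mulr0.
Qed.

Lemma mlead_eq p m : p@_m != 0 -> (forall k, p@_k != 0 -> (k <= m)%O) -> mlead p = m.
Proof.
move=> pm le; have mp : m \in msupp p by rewrite mcoeff_msupp.
have p0 : p != 0 by apply: contraNneq pm => ->; rewrite mcoeff0.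
apply/le_anti; rewrite msupp_le_mlead // andbT le // -mcoeff_msupp.
exact: mlead_supp.
Qed.

Lemma mcoeff_mlead p : p != 0 -> p@_(mlead p) != 0.
Proof. by rewrite mleadc_eq0. Qed.

Lemma leading_monomials_homog J m : graded_ideal J -> leading_monomials J m ->
  exists q, [/\ J q, q \is (mdeg m).-homog, q != 0 & mlead q = m].
Proof.
case=> _ _ _ JH [p [Jp p0 <-]]; set d := mdeg _.
have lead_q : mlead (pihomog mdeg d p) = mlead p.
  apply: mlead_eq => [|k]; rewrite mcoeff_pihomog; first by rewrite eqxx mcoeff_mlead.
  case: ifP => _; last by rewrite eqxx.
  by rewrite -mcoeff_msupp; exact: msupp_le_mlead.
exists (pihomog mdeg d p); split=> //; [exact: JH | exact: pihomogP |].
by rewrite -mleadc_eq0 lead_q mcoeff_pihomog eqxx mcoeff_mlead.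
Qed.

Lemma mlead_cancel p q (p0 : p != 0) (q0 : q != 0) : mlead q = mlead p ->
  let p' := p - (p@_(mlead p) / q@_(mlead p)) *: q in
  p' = 0 \/ (mlead p' < mlead p)%O.
Proof.
move=> qp p'; have [->|p'0] := eqVneq p' 0; [by left | right].
have cancel : p'@_(mlead p) = 0.
  by rewrite mcoeffB mcoeffZ divfK ?subrr // -qp mcoeff_mlead.
rewrite lt_neqAle; apply/andP; split.
  by apply: contraTneq (mcoeff_mlead p'0) => ->; rewrite cancel eqxx.
rewrite leNgt; apply/negP => lt; have ltq := lt; rewrite -qp in ltq.
have := mcoeff_mlead p'0; rewrite mcoeffB mcoeffZ (mcoeff_gt_mlead lt).
by rewrite (mcoeff_gt_mlead ltq) mulr0 subrr eqxx.
Qed.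

(** The monomials that lead no element of J form a basis of the quotient: they
    are independent because a nonzero combination has one of them as leading
    monomial, and they generate by the division algorithm. *)
Lemma hilbert_fun_standard J j (s : seq 'X_{1..n}) : graded_ideal J -> uniq s ->
  (forall m, m \in s <-> mdeg m = j /\ ~ leading_monomials J m) ->
  hilbert_fun J j = size s.
Proof.
move=> gJ us sP; case: (gJ) => J0 JD JM _.
pose e i : {mpoly K[n]} := 'X_[tnth (in_tuple s) i].
have s_tnth i : tnth (in_tuple s) i \in s by exact: mem_tnth.
have coef_e (a : 'I_(size s) -> K) i : (\sum_k a k *: e k)@_(tnth (in_tuple s) i) = a i.
  rewrite raddf_sum (bigD1 i) //= mcoeffZ mcoeffX eqxx mulr1 big1 ?addr0 // => k ki.
  rewrite mcoeffZ mcoeffX (tnth_nth 0%MM) (tnth_nth 0%MM) nth_uniq //.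
  by rewrite (inj_eq val_inj) (negbTE ki) mulr0.
apply: (@quot_basis_size _ _ _ _ _ e) => //; split.
- by move=> i; rewrite dhomogX; apply/eqP; have [+ _] := (sP _).1 (s_tnth i).
- move=> a Ja; suff a0 : \sum_i a i *: e i = 0.
    by move=> i; rewrite -(coef_e a) a0 mcoeff0.
  apply: contrapT => /eqP nz.
  have : mlead (\sum_i a i *: e i) \in s.
    have := mcoeff_mlead nz; rewrite raddf_sum /=; apply: contraNT => nin.
    rewrite big1 // => i _; rewrite mcoeffZ mcoeffX; case: eqP => [E|]; rewrite ?mulr0 //.
    by rewrite -E s_tnth in nin.
  by case/sP => _; apply; exists (\sum_i a i *: e i).
- have zero : exists a : 'I_(size s) -> K, J (0 - \sum_i a i *: e i).
    by exists (fun=> 0); rewrite big1 ?subrr // => i _; rewrite scale0r.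
  suff main m p : p != 0 -> mlead p = m -> p \is j.-homog ->
      exists a : 'I_(size s) -> K, J (p - \sum_i a i *: e i).
    by move=> p; have [->|p0] := eqVneq p 0 => // hp; exact: main hp.
  elim/(well_founded_ind (@ltom_wf n)): m p => m IH p p0 pm hp.
  have step q : q != 0 -> mlead q = mlead p -> q \is j.-homog ->
      exists a : 'I_(size s) -> K,
        J (p - (p@_(mlead p) / q@_(mlead p)) *: q - \sum_i a i *: e i).
    move=> q0 qp hq; case: (mlead_cancel p0 q0 qp) => [->//|lt].
    set p' := p - _ in lt *; have [->//|p'0] := eqVneq p' 0.
    apply: IH p'0 erefl _; first by rewrite -pm.
    by rewrite rpredB // rpredZ.
  have deg_m : mdeg m = j.
    by rewrite -pm (dhomog_mf hp) // mlead_supp.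
  have [[]|nLM] := pselect (leading_monomials J m).
    move=> q0 Hq0.
    have [|q [Jq hq q0' qm]] := @leading_monomials_homog J m gJ; first by exists q0.
    have [||a Ja] := step q q0'; rewrite ?qm -?deg_m //.
    exists a; have := JD _ _ Ja (JM (p@_m / q@_m)%:MP _ Jq).
    by rewrite mul_mpolyC pm; congr J; rewrite addrAC subrK.
  have /sP ms : mdeg m = j /\ ~ leading_monomials J m by [].
  have Xm : mlead ('X_[m] : {mpoly K[n]}) = m by rewrite mleadXm.
  have X0 : 'X_[m] != 0 :> {mpoly K[n]}.
    by rewrite -mleadc_eq0 Xm mcoeffX eqxx oner_eq0.
  have hX : ('X_[m] : {mpoly K[n]}) \is j.-homog by rewrite dhomogX; apply/eqP.
  have [|a Ja] := step _ X0 _ hX; first by rewrite Xm.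
  have im : (index m s < size s)%N by rewrite index_mem ms.
  exists (fun i => (i == Ordinal im)%:R * p@_m + a i); move: Ja; congr J.
  rewrite pm mcoeffX eqxx divr1 -addrA -opprD; congr (_ - _).
  under [RHS]eq_bigr => i _ do rewrite scalerDl.
  rewrite big_split /=; congr (_ + _).
  rewrite (bigD1 (Ordinal im)) //= eqxx mul1r big1 ?addr0 => [|i ne].
    by rewrite /e (tnth_nth 0%MM) /= nth_index.
  by rewrite (negbTE ne) mul0r scale0r.
Qed.

End LeadingMonomials.

(** * Increasing renamings of variables *)

Section Renaming.
Variables (N M : nat) (f : 'I_N -> 'I_M).
Hypothesis f_incr : forall i j : 'I_N, (i < j)%N -> (f i < f j)%N.

Definition rename (m : 'X_{1..N}) : 'X_{1..M} :=
  [multinom (\sum_(i | f i == l) m i)%N | l < M].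

Lemma f_incr_inj : injective f.
Proof.
move=> i j fij; apply/val_inj; case: (ltngtP i j) => // /f_incr;
  by rewrite fij ltnn.
Qed.

Lemma rename_image m i : rename m (f i) = m i.
Proof.
rewrite mnmE (bigD1 i) //= big1 ?addn0 // => j /andP[/eqP/f_incr_inj->].
by rewrite eqxx.
Qed.

Lemma rename_notin m l : (forall i, f i != l) -> rename m l = 0%N.
Proof. by move=> fl; rewrite mnmE big1 // => i; rewrite (negbTE (fl i)). Qed.

Lemma rename_inj : injective rename.
Proof. by move=> m m' E; apply/mnmP => i; rewrite -!rename_image E. Qed.

Lemma mdeg_rename m : mdeg (rename m) = mdeg m.
Proof.
rewrite !mdegE; under eq_bigr => l _ do rewrite mnmE.
rewrite (exchange_big_dep predT) //=; apply: eq_bigr => i _.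
by rewrite (bigD1 (f i)) //= big1 ?addn0 // => l /andP[/eqP->]; rewrite eqxx.
Qed.

(** The order is lexicographic within each degree, so it only depends on the
    relative order of the variables. *)
Lemma rename_lt m m' : (m < m')%O -> (rename m < rename m')%O.
Proof.
move=> lt; have [ltd|] := ltnP (mdeg m) (mdeg m').
  by apply: lt_mdeg_ltmc; rewrite !mdeg_rename.
move=> ged; have eqd : mdeg m = mdeg m'.
  by apply/eqP; rewrite eqn_leq ged lemc_mdeg // ltW.
have [i eq_lt lt_i] := ltmcP eqd lt.
apply/ltmcP; first by rewrite !mdeg_rename.
exists (f i); last by rewrite !rename_image.
move=> l lfi; have [[j fj]|nl] := pselect (exists j, f j = l); last first.
  by rewrite !rename_notin // => j; apply/eqP => fj; apply: nl; exists j.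
rewrite -fj in lfi *; rewrite !rename_image eq_lt //.
case: (ltngtP j i) => // [/f_incr|/val_inj ji].
  by move=> /(ltn_trans lfi); rewrite ltnn.
by rewrite ji ltnn in lfi.
Qed.

Lemma rename_le m m' : (m <= m')%O -> (rename m <= rename m')%O.
Proof. by rewrite le_eqVlt => /orP[/eqP->//|/rename_lt/ltW]. Qed.

Variables (K : fieldType) (lq : N.-tuple {mpoly K[M]}).
Hypothesis lqE : forall i, tnth lq i = 'X_(f i).

Lemma comp_mpoly_rename p :
  p \mPo lq = \sum_(m <- msupp p) p@_m *: 'X_[rename m].
Proof.
rewrite comp_mpolyE; apply: eq_bigr => m _; congr (_ *: _).
under eq_bigr => i _ do rewrite lqE mpolyXn.
rewrite mprodXE; congr 'X_[_]; apply/mnmP => l.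
rewrite mnm_sumE mnmE [RHS]big_mkcond; apply: eq_bigr => i _.
by rewrite mulmnE mnm1E; case: eqP; rewrite ?mul1n.
Qed.

Lemma mlead_comp_rename p : p != 0 ->
  p \mPo lq != 0 /\ mlead (p \mPo lq) = rename (mlead p).
Proof.
move=> p0; have lead : (p \mPo lq)@_(rename (mlead p)) != 0.
  rewrite comp_mpoly_rename raddf_sum (bigD1_seq (mlead p)) ?mlead_supp //=.
  rewrite mcoeffZ mcoeffX eqxx mulr1 big1 ?addr0 ?mcoeff_mlead // => m ne.
  by rewrite mcoeffZ mcoeffX (inj_eq rename_inj) (negbTE ne) mulr0.
split; first by apply: contraNneq lead => ->; rewrite mcoeff0.
apply: mlead_eq => // k; apply: contraNT => nle.
rewrite comp_mpoly_rename raddf_sum big_seq big1 // => m mp /=.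
rewrite mcoeffZ mcoeffX; case: eqP => [E|]; last by rewrite mulr0.
by rewrite -E rename_le // msupp_le_mlead in nle.
Qed.

End Renaming.

(** * Monomials as words *)

Section MonomialsAsWords.
Variable c : nat.
Notation letter := (c.-tuple nat).
Notation word := (seq letter).

Definition unindex n (i : 'I_(c * n)) : 'I_c * 'I_n :=
  enum_val (cast_ord (esym (mxvec_cast c n)) i).

Lemma mxvec_indexK n j k : unindex (@mxvec_index c n j k) = (j, k).
Proof. by rewrite /unindex cast_ordK enum_rankK. Qed.

Lemma index_allpairs (S T : eqType) (s : seq S) (t : seq T) x y :
  x \in s -> y \in t ->
  index (x, y) [seq (a, b) | a <- s, b <- t] = (index x s * size t + index y t)%N.
Proof.
move=> + yt; elim: s => // a s IH; rewrite inE allpairs_cons index_cat /=.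
have [->|ne] := eqVneq x a => /= [_|xs].
  by rewrite map_f // mul0n index_map // => ? ? [].
case: ifP => [/mapP[b _ [xa]]|_]; first by rewrite xa eqxx in ne.
by rewrite size_map IH // mulSn addnA.
Qed.

Lemma val_mxvec_index n (j : 'I_c) (k : 'I_n) : mxvec_index j k = (j * n + k)%N :> nat.
Proof.
have enum_pairs : enum {: 'I_c * 'I_n} = [seq (a, b) | a <- enum 'I_c, b <- enum 'I_n].
  by rewrite enumT unlock.
have rankE (x : 'I_c * 'I_n) : enum_rank x = index x (enum {: 'I_c * 'I_n}) :> nat.
  by rewrite -{2}(nth_enum_rank x x) index_uniq ?enum_uniq // -cardT ltn_ord.
rewrite /= rankE enum_pairs index_allpairs ?mem_enum //.
by rewrite !index_enum_ord size_enum_ord.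
Qed.

Definition word_mnm n (w : word) : 'X_{1..c * n} :=
  [multinom tnth (nth [tuple 0%N | _ < c] w (unindex i).2) (unindex i).1 | i < c * n].

Lemma word_mnmE n w (j : 'I_c) (k : 'I_n) :
  word_mnm n w (mxvec_index j k) = tnth (nth [tuple 0%N | _ < c] w k) j.
Proof. by rewrite mnmE mxvec_indexK. Qed.

Lemma mdeg_word_mnm n w : size w = n -> mdeg (word_mnm n w) = word_deg w.
Proof.
move=> wn; rewrite mdegE (reindex _ (curry_mxvec_bij c n)) /=.
rewrite (eq_bigr (fun jk => word_mnm n w (mxvec_index jk.1 jk.2))) => [|[j k] _ //].
rewrite -(pair_bigA _ (fun j k => word_mnm n w (mxvec_index j k))) exchange_big.
rewrite /word_deg (big_nth [tuple 0%N | _ < c]) wn big_mkord.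
apply: eq_bigr => k _; rewrite sumnE big_tuple.
by apply: eq_bigr => j _; rewrite word_mnmE.
Qed.

Lemma word_mnm_inj n w w' : size w = n -> size w' = n ->
  word_mnm n w = word_mnm n w' -> w = w'.
Proof.
move=> wn w'n E; apply: (@eq_from_nth _ [tuple 0%N | _ < c]) => [|k].
  by rewrite wn w'n.
rewrite wn => kn; apply/eq_from_tnth => j.
by rewrite -(word_mnmE w j (Ordinal kn)) E word_mnmE.
Qed.

Lemma word_mnm_surj n (m : 'X_{1..c * n}) :
  exists2 w, size w = n & word_mnm n w = m.
Proof.
exists [seq [tuple m (mxvec_index j k) | j < c] | k <- enum 'I_n].
  by rewrite size_map size_enum_ord.
apply/mnmP => i; case/mxvec_indexP: i => j k.
by rewrite word_mnmE (nth_map k) ?size_enum_ord // nth_ord_enum tnth_mktuple.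
Qed.

(** The renaming of variables that makes room for a new letter at position h. *)
Definition insert_column n (h : 'I_n.+1) (i : 'I_(c * n)) : 'I_(c * n.+1) :=
  mxvec_index (unindex i).1 (lift h (unindex i).2).

(** The variables are numbered row by row, and each row is mapped to the row with
    the same index, increasingly. *)
Lemma insert_column_incr n (h : 'I_n.+1) (i i' : 'I_(c * n)) :
  (i < i')%N -> (insert_column h i < insert_column h i')%N.
Proof.
case/mxvec_indexP: i => j k; case/mxvec_indexP: i' => j' k'.
rewrite /insert_column !mxvec_indexK !val_mxvec_index.
have := ltn_ord k; have := ltn_ord k'; have := ltn_ord h; rewrite /= /bump.
case: (ltngtP j j') => [lt|lt|->] h1 h2 h3; last 2 first.
- have : (j'.+1 * n <= j * n)%N by rewrite leq_mul2r lt orbT.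
  by rewrite mulSn; lia.
- by rewrite !ltn_add2l; lia.
have : (j.+1 * n.+1 <= j' * n.+1)%N by rewrite leq_mul2r lt orbT.
by rewrite mulSn; lia.
Qed.

Lemma rename_insert_le n (u v : word) a (h : 'I_n.+1) : size u = h ->
  (rename (insert_column h) (word_mnm n (u ++ v)) <= word_mnm n.+1 (u ++ a :: v))%MM.
Proof.
move=> uh; apply/mnm_lepP => i; case/mxvec_indexP: i => j k.
case: (unliftP h k) => [k'|] ->.
  have -> : mxvec_index j (lift h k') = insert_column h (mxvec_index j k').
    by rewrite /insert_column mxvec_indexK.
  rewrite rename_image; last exact: insert_column_incr.
  rewrite /insert_column mxvec_indexK !word_mnmE !nth_cat uh /= /bump.
  case: (leqP h k') => hk; first by rewrite add1n ltnNge leqW //= subSn.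
  by rewrite add0n hk.
rewrite rename_notin // => i; case/mxvec_indexP: i => j' k'.
rewrite /insert_column mxvec_indexK; apply/eqP => /(congr1 (@unindex n.+1)).
by rewrite !mxvec_indexK => -[_ /eqP]; rewrite eq_sym (negbTE (neq_lift _ _)).
Qed.

(** Inserting an empty column at h is the embedding of K[X_n] in K[X_{n+1}]
    followed by the permutation that moves the last column to position h. *)
Lemma leading_monomials_insert (K : fieldType) (I : forall n, set {mpoly K[c * n]})
    n (h : 'I_n.+1) (m : 'X_{1..c * n}) : sym_filtration I ->
  leading_monomials (I n) m ->
  leading_monomials (I n.+1) (rename (insert_column h) m).
Proof.
case=> _ _ act [p [Ip p0 <-]].
pose pi : 'S_n.+1 := lift_perm ord_max h 1.
have pi_widen k : pi (widen_ord (leqnSn n) k) = lift h k.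
  have -> : widen_ord (leqnSn n) k = lift ord_max k.
    by apply/val_inj; rewrite /= /bump leqNgt ltn_ord.
  by rewrite lift_perm_lift perm1.
pose lq : (c * n).-tuple {mpoly K[c * n.+1]} := mktuple (fun i =>
  let: (j, k) := unindex i in xvar K j (pi (widen_ord (leqnSn n) k))).
have lqE i : tnth lq i = 'X_(insert_column h i).
  rewrite tnth_mktuple /insert_column; case: (unindex i) => j k /=.
  by rewrite /xvar pi_widen.
have [q0 qlead] := mlead_comp_rename (@insert_column_incr n h) lqE p0.
by exists (sym_act (leqnSn n) pi p); split=> //; exact: act.
Qed.

Definition standard_words (K : fieldType) (I : forall n, set {mpoly K[c * n]}) : set word :=
  [set w | ~ leading_monomials (I (size w)) (word_mnm (size w) w)].

Lemma standard_words_downset (K : fieldType) (I : forall n, set {mpoly K[c * n]}) :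
  sym_filtration I -> downset (standard_words I).
Proof.
move=> symI u v uv; apply: contra_not.
(* A common prefix w makes the steps of the embedding act at any position. *)
suff main w : leading_monomials (I (size (w ++ u))) (word_mnm (size (w ++ u)) (w ++ u)) ->
    leading_monomials (I (size (w ++ v))) (word_mnm (size (w ++ v)) (w ++ v)).
  exact: (main [::]).
have [_ gI _] := symI.
elim: uv w => // [a {}u {}v _ IH|a b {}u {}v ab _ IH] w.
  move=> /IH; rewrite !size_cat /= addnS => LMv.
  have hw : (size w < (size w + size v).+1)%N by rewrite ltnS leq_addr.
  apply: leading_monomials_up (leading_monomials_insert (Ordinal hw) symI LMv) => //.
  exact: rename_insert_le.
rewrite -!cat_rcons => /IH LMv.
have sizeE : size (rcons w b ++ v) = size (rcons w a ++ v).
  by rewrite !size_cat !size_rcons.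
rewrite sizeE; apply: leading_monomials_up LMv => //.
apply/mnm_lepP => i; case/mxvec_indexP: i => j k; rewrite !word_mnmE !nth_cat !size_rcons.
by case: ifP => // _; rewrite !nth_rcons; case: ifP => // _; case: ifP.
Qed.

Lemma hilbert_series_words (K : fieldType) (I : forall n, set {mpoly K[c * n]}) :
  sym_filtration I -> bigraded_hilbert_series I = word_series (standard_words I).
Proof.
case=> _ gI _; apply/funext => n; apply/funext => j; congr Posz.
rewrite -size_filter; set s := filter _ _.
have sizes w : w \in s -> size w = n.
  by rewrite mem_filter mem_words => /andP[_ /andP[/eqP]].
rewrite -(size_map (word_mnm n)).
apply: hilbert_fun_standard => [//||m].
  rewrite map_inj_in_uniq ?filter_uniq ?words_uniq // => w w' /sizes wn /sizes w'n.
  exact: word_mnm_inj.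
have [w wn <-] := word_mnm_surj m; rewrite mdeg_word_mnm //.
split=> [/mapP[w' w's /word_mnm_inj E]|[wj nLM]].
  have {}E : w = w' by apply: E => //; exact: sizes.
  move: w's; rewrite -E mem_filter mem_words => /andP[/asboolP + /andP[_ /eqP->]].
  by rewrite /standard_words /= wn.
apply: map_f; rewrite mem_filter mem_words wn wj !eqxx !andbT.
by apply/asboolP; rewrite /standard_words /= wn.
Qed.

End MonomialsAsWords.

Theorem theorem7p7 (K : fieldType) (c : nat) (c_ge1 : (1 <= c)%N)
    (I : forall n : nat, set {mpoly K[c * n]}) (symI : sym_filtration I) :
  exists (a b : nat) (e : 'I_b -> nat) (f : 'I_b -> {poly int})
         (g : {poly {poly int}}),
    [/\ forall j, (e j <= c)%N,
        forall j, 0 < (f j).[1]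
      & series2_eq_frac (bigraded_hilbert_series I) g (hilbert_denom a e f)].
Proof.
have [a [l [g [hl E]]]] := downset_rational (standard_words_downset symI).
exists a, (size l), (fun j => (tnth (in_tuple l) j).1),
  (fun j => (tnth (in_tuple l) j).2), g.
split=> [j|j|]; [by case: (hl _ (mem_tnth j (in_tuple l)))..|].
rewrite /series2_eq_frac hilbert_series_words //.
rewrite -[RHS]/(ser_of_poly g) -E series2_mulE.
congr (_ * ser_of_poly _); rewrite /hilbert_denom /denom; congr (_ * _).
by rewrite (big_tuple _ _ (in_tuple l)).
Qed.
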